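(* Let $|q|<1$ and $\sigma_2(q)=\sum_{n=0}^{\infty}\frac{(-1)^nq^{n^2}}{(-q;q)_n}$. Then \[ \text{(i)}\quad \sigma_2(q)=\frac{1}{(-q;q)_{\infty}}\left\{1+\sum_{n=1}^{\infty}\frac{(-1)^nq^{n(5n-1)/2}(1+q^{2n})}{1+q^n}\sum_{j=0}^{n}\frac{(-1;q)_j}{(q;q)_j}\left(-q^{1-n}\right)^j\right\}, \] \[ \text{(ii)}\quad \sigma_2(q)=\frac{1}{(-q;q)_{\infty}}\left\{1-\sum_{n=1}^{\infty}\frac{(-1)^nq^{n(5n-1)/2}(1+q^{2n})}{1-q^n}\sum_{m=0}^{n-1}\frac{(-1;q)_m}{(q;q)_m}\left(-q^{-n}\right)^m\right\}. \]
   Context: Notation: $(a;q)_0=1$, $(a;q)_n=\prod_{k=0}^{n-1}(1-aq^k)$ for $n\ge1$, $(a;q)_\infty=\prod_{k=0}^{\infty}(1-aq^k)$. *)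

(* Defs.v *)
From HB Require Import structures.
From mathcomp Require Import all_boot all_order all_algebra.
From mathcomp Require Import all_classical all_reals all_analysis.
From mathcomp Require Import complex.

Set Implicit Arguments.
Unset Strict Implicit.
Unset Printing Implicit Defensive.

Import Order.TTheory GRing.Theory Num.Theory.
Import numFieldNormedType.Exports.

Local Open Scope classical_set_scope.
Local Open Scope ring_scope.
Local Open Scope complex_scope.

(* R[i] is only a numClosedFieldType in real-closed; give it the topology and
   norm that MathComp-Analysis puts on every numFieldType, so that limits of
   complex sequences make sense. The redundant projections are convertible. *)
#[warnings="-redundant-canonical-projection"]
HB.instance Definition _ (R : rcfType) := NormedModule.copy R[i] R[i]^o.

Definition qpoch (R : realType) (a q : R[i]) (n : nat) : R[i] :=
  \prod_(0 <= k < n) (1 - a * q ^+ k).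

(* This and the infinite sums below are [limn] of the partial products (sums),
   hence meaningful only together with the corresponding [cvgn] fact. *)
Definition qpoch_infty (R : realType) (a q : R[i]) : R[i] :=
  (\big[*%R/1%R]_(0 <= k <oo) (1 - a * q ^+ k))%BIG.

Definition sigma2_term (R : realType) (q : R[i]) (n : nat) : R[i] :=
  (-1) ^+ n * q ^+ (n ^ 2) / qpoch (- q) q n.

Definition sigma2 (R : realType) (q : R[i]) : R[i] :=
  (\big[+%R/0%R]_(0 <= n <oo) sigma2_term q n)%BIG.

(* The general terms of the two outer sums, used for n >= 1 only, where the
   truncated subtraction 5 n - 1 is the true one and n (5 n - 1) is even.
   For q = 0 the negative powers of q are junk, but they are multiplied by
   q ^+ (n (5 n - 1) / 2) = 0. The total exponent of q in each product is
   positive, so 0 is also the value of the simplified term at q = 0. *)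
Definition term_i (R : realType) (q : R[i]) (n : nat) : R[i] :=
  (-1) ^+ n * q ^+ (n * (5 * n - 1))./2 * (1 + q ^+ (2 * n)) / (1 + q ^+ n)
  * \sum_(0 <= j < n.+1)
      qpoch (-1) q j / qpoch q q j * (- q ^ (1 - n%:Z)) ^+ j.

Definition term_ii (R : realType) (q : R[i]) (n : nat) : R[i] :=
  (-1) ^+ n * q ^+ (n * (5 * n - 1))./2 * (1 + q ^+ (2 * n)) / (1 - q ^+ n)
  * \sum_(0 <= m < n)
      qpoch (-1) q m / qpoch q q m * (- q ^- n) ^+ m.

(* Main.v *)
Require Import Defs.
From HB Require Import structures.
From mathcomp Require Import all_boot all_order all_algebra.
From mathcomp Require Import all_classical all_reals all_analysis.
From mathcomp Require Import complex.
From mathcomp Require Import ring zify.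

(** Put E_n = q^(n(3n-1)/2) S_n / (1 + q^n), where S_n is the inner sum of (i),
    and T_n the inner sum of (ii). The recurrence
    (1 - q^(j+1)) A_(j+1) = (1 + q^j) A_j for A_j = (-1;q)_j / (q;q)_j gives
    (1 + q^n) T_n = - (1 - q^n) S_n, so that (ii) is (i) term by term, and a
    first-order recurrence for E_n. Zeilberger-type telescoping with that
    recurrence shows that alpha_n = (1 + q^(2n)) E_n and
    beta_n = 1 / (-q;q)_n form a Bailey pair relative to a = -1. The finite
    Bailey lemma (q-Chu-Vandermonde) then yields
      sum_(n <= N) (-1)^n q^(n^2) beta_n / (q;q)_(N-n)
      = sum_(r <= N) (-1)^r q^(r^2) alpha_r / ((q;q)_(N-r) (-q;q)_(N+r)),
    and both sides, multiplied by (q;q)_N, differ by O(|q|^N) from the partial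
    sums of sigma_2 and of the right-hand side of (i). *)

Set Implicit Arguments.
Unset Strict Implicit.
Unset Printing Implicit Defensive.

Import Order.TTheory GRing.Theory Num.Theory.
Import numFieldNormedType.Exports.

Local Open Scope classical_set_scope.
Local Open Scope ring_scope.
Local Open Scope complex_scope.

(** Exponents n(n-1)/2 are kept as binomials, which [binS] splits; this relates them to squares. *)
Lemma muln_bin2 n : (n * n = 'C(n, 2) * 2 + n)%N.
Proof. by elim: n => // n IH; rewrite binS bin1; nia. Qed.

(** * q-Pochhammer symbols and the Bailey pair relative to -1 *)

Section Algebra.
Variables (R : realType) (q : R[i]).

Lemma qpoch0 (a : R[i]) : qpoch a q 0 = 1.
Proof. by rewrite /qpoch big_geq. Qed.

Lemma qpochS (a : R[i]) n : qpoch a q n.+1 = qpoch a q n * (1 - a * q ^+ n).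
Proof. by rewrite /qpoch big_nat_recr. Qed.

Lemma qpochqS n : qpoch q q n.+1 = qpoch q q n * (1 - q ^+ n.+1).
Proof. by rewrite qpochS exprS. Qed.

Lemma qpochNqS n : qpoch (- q) q n.+1 = qpoch (- q) q n * (1 + q ^+ n.+1).
Proof. by rewrite qpochS mulNr opprK exprS. Qed.

Lemma qpochN1S n : qpoch (-1) q n.+1 = qpoch (-1) q n * (1 + q ^+ n).
Proof. by rewrite qpochS mulN1r opprK. Qed.

Definition ratio_coef n : R[i] := qpoch (-1) q n / qpoch q q n.

(* E_n of the header, defined by its recurrence because the closed form has
   negative powers of q, which are junk at q = 0. *)
Fixpoint bailey_e n : R[i] :=
  if n is m.+1 then
    - (q ^+ (3 * m).+1 * (1 - q ^+ m) / (1 + q ^+ m.+1)) * bailey_e m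
    + (-1) ^+ m.+1 * ratio_coef m * q ^+ 'C(m.+2, 2) * (1 + q ^+ (2 * m).+1)
      / ((1 + q ^+ m.+1) * (1 - q ^+ m.+1))
  else 2^-1.
Arguments bailey_e : simpl never.

Lemma bailey_e0 : bailey_e 0 = 2^-1.
Proof. by []. Qed.

Lemma bailey_eS n : bailey_e n.+1 =
  - (q ^+ (3 * n).+1 * (1 - q ^+ n) / (1 + q ^+ n.+1)) * bailey_e n
  + (-1) ^+ n.+1 * ratio_coef n * q ^+ 'C(n.+2, 2) * (1 + q ^+ (2 * n).+1)
    / ((1 + q ^+ n.+1) * (1 - q ^+ n.+1)).
Proof. by []. Qed.

(** The kernel 1 / ((q;q)_(n-r) (aq;q)_(n+r)) of Bailey pairs at a = -1, meant for r <= n because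
    [n - r] is truncated. *)
Definition bailey_w n r : R[i] := (qpoch q q (n - r) * qpoch (- q) q (n + r))^-1.

(** Summand of a limiting q-Chu-Vandermonde sum with a = -q^s, where (aq;q)_m is (-q;q)_(s+m) /
    (-q;q)_s. *)
Definition vandermonde_term s M m : R[i] :=
  (-1) ^+ m * q ^+ (m ^ 2 + s * m)
  / (qpoch q q m * qpoch q q (M - m) * qpoch (- q) q (s + m)).

Hypothesis hq : `|q| < 1.

Lemma normqX_lt1 n : `|q ^+ n.+1| < 1.
Proof. by rewrite normrX exprn_ilt1. Qed.

Lemma subr1X_neq0 n : 1 - q ^+ n.+1 != 0.
Proof.
rewrite subr_eq0; apply/eqP => h; have := normqX_lt1 n.
by rewrite -h normr1 ltxx.
Qed.

Lemma addr1X_neq0 n : 1 + q ^+ n != 0.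
Proof.
case: n => [|n]; first by rewrite expr0 -(natrD _ 1 1) pnatr_eq0.
rewrite addr_eq0; apply/eqP => h; have := normqX_lt1 n.
by rewrite -normrN -h normr1 ltxx.
Qed.

Lemma qpochq_neq0 n : qpoch q q n != 0.
Proof.
elim: n => [|n IH]; first by rewrite qpoch0 oner_eq0.
by rewrite qpochqS mulf_neq0 // subr1X_neq0.
Qed.

Lemma qpochNq_neq0 n : qpoch (- q) q n != 0.
Proof.
elim: n => [|n IH]; first by rewrite qpoch0 oner_eq0.
by rewrite qpochNqS mulf_neq0 // addr1X_neq0.
Qed.

Lemma ratio_coefS n :
  ratio_coef n.+1 = ratio_coef n * (1 + q ^+ n) / (1 - q ^+ n.+1).
Proof.
rewrite /ratio_coef qpochN1S qpochqS.
have := qpochq_neq0 n; have := subr1X_neq0 n; move=> h1 h2.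
by field; rewrite h1 h2.
Qed.

(* Rational certificate: the first term in the brackets telescopes the
   inhomogeneous part of the recurrence of [bailey_e], the second one the rest. *)
Lemma bailey_partial n k : (k <= n.+1)%N ->
  \sum_(0 <= r < k) ((1 + q ^+ n.+1) * bailey_w n.+1 r - bailey_w n r)
     * (1 + q ^+ (2 * r)) * bailey_e r
  = bailey_w n.+1 k * (1 + q ^+ (n.+1 + k))
    * (q ^+ n.+1 * (-1) ^+ k * ratio_coef k * q ^+ 'C(k, 2)
         * (q ^+ k - q ^+ n.+1) / (1 - q ^+ n.+1)
       - q ^+ (n.+1 - k) * (1 + q ^+ k) * bailey_e k).
Proof.
elim: k => [|k IH] lekn.
  (* At k = 0 both terms in the brackets equal q^(n+1), since [bailey_e 0] is 1/2. *)
  rewrite big_geq // /ratio_coef !qpoch0 subn0 addn0 /=.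
  have h1 := subr1X_neq0 n.
  rewrite bin0n !expr0 bailey_e0.
  by field; rewrite ?h1 ?pnatr_eq0.
rewrite big_nat_recr //= IH ?(ltnW lekn) //.
(* Writing n = k + m removes the truncated subtractions, so every power of q becomes a monomial in
   q, q^k, q^m and q^C(k,2). *)
have [m ->] : exists m, n = (k + m)%N by exists (n - k)%N; lia.
rewrite /bailey_w.
have -> : ((k + m).+1 - k = m.+1)%N by lia.
have -> : ((k + m).+1 - k.+1 = m)%N by lia.
have -> : (k + m - k = m)%N by lia.
have -> : ((k + m).+1 + k = (k + m + k).+1)%N by lia.
have -> : ((k + m).+1 + k.+1 = (k + m + k).+2)%N by lia.
have d1 := addr1X_neq0 (k + m + k).+2.
have d2 := addr1X_neq0 (k + m + k).+1.
have d3 := subr1X_neq0 m.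
have d4 := subr1X_neq0 k.
have d5 := addr1X_neq0 k.+1.
have d6 := subr1X_neq0 (k + m).
have d7 := qpochq_neq0 m.
have d8 := qpochNq_neq0 (k + m + k).
rewrite !qpochNqS qpochqS ratio_coefS bailey_eS !binS !bin1 !bin0.
have -> : ('C(k, 2) + k + (k + 1) = 'C(k, 2) + k + k + 1)%N by lia.
move: d1 d2 d3 d4 d5 d6 d7 d8.
rewrite !mul2n -!addnn (_ : 3 * k = k + k + k)%N; last by lia.
rewrite !exprS !exprD ?expr1.
(* With these atoms generalized, a plain identity of rational functions is left. *)
move: (q ^+ k) (q ^+ m) (q ^+ 'C(k, 2)) (ratio_coef k) (bailey_e k)
  ((-1) ^+ k) (qpoch q q m) (qpoch (- q) q (k + m + k)).
move=> t s B A E sg X Y d1 d2 d3 d4 d5 d6 d7 d8.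
field.
by rewrite ?d1 ?d2 ?d3 ?d4 ?d5 ?d6 ?d7 ?d8.
Qed.

(** By induction: at k = n+1 the first term of the certificate vanishes with q^k - q^(n+1), and the
    second is minus the missing summand r = n+1. Hence 1 + q^(n+1) times the sum for n+1 is the sum
    for n. *)
Lemma bailey_pair n :
  \sum_(0 <= r < n.+1) bailey_w n r * ((1 + q ^+ (2 * r)) * bailey_e r)
  = (qpoch (- q) q n)^-1.
Proof.
elim: n => [|n IH].
  rewrite big_nat1 /bailey_w !qpoch0 bailey_e0 expr0.
  by field; rewrite ?pnatr_eq0.
have d := addr1X_neq0 n.+1.
apply: (mulfI d).
rewrite qpochNqS invfM mulrCA mulfV // mulr1 -IH big_nat_recr //= mulrDr mulr_sumr.
have := bailey_partial (leqnn n.+1).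
rewrite subrr mulr0 mul0r sub0r subnn expr0 mul1r addnn -mul2n => H.
pose A r := (1 + q ^+ n.+1) * (bailey_w n.+1 r * ((1 + q ^+ (2 * r)) * bailey_e r)).
pose B r := bailey_w n r * ((1 + q ^+ (2 * r)) * bailey_e r).
have {}H : \sum_(0 <= r < n.+1) A r - \sum_(0 <= r < n.+1) B r = - A n.+1.
  rewrite -sumrB /A /B; transitivity (bailey_w n.+1 n.+1 * (1 + q ^+ (2 * n.+1)) *
    - ((1 + q ^+ n.+1) * bailey_e n.+1)); last by ring.
  by rewrite -H; apply: eq_bigr => r _; ring.
by rewrite -[LHS]/(_ + A n.+1) -[RHS]/(\sum_(0 <= r < n.+1) B r) -[A n.+1]opprK
  -H opprB addrC subrK.
Qed.

(** * The q-Chu-Vandermonde sum and the finite Bailey lemma *)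

Lemma vandermonde_partial s M k : (k <= M.+1)%N ->
  \sum_(0 <= m < k) ((1 - q ^+ M.+1) * (1 + q ^+ (s + M.+1))
     * vandermonde_term s M.+1 m - vandermonde_term s M m)
  = - (q ^+ (M.+1 - k) * vandermonde_term s M.+1 k
       * (1 - q ^+ k) * (1 + q ^+ (s + k))).
Proof.
elim: k => [|k IH] lekn.
  by rewrite big_geq // expr0 subrr mulr0 mul0r oppr0.
rewrite big_nat_recr //= IH ?(ltnW lekn) //.
have [m ->] : exists m, M = (k + m)%N by exists (M - k)%N; lia.
rewrite /vandermonde_term.
have -> : ((k + m).+1 - k = m.+1)%N by lia.
have -> : ((k + m).+1 - k.+1 = m)%N by lia.
have -> : (k + m - k = m)%N by lia.
have -> : (k.+1 ^ 2 + s * k.+1 = k ^ 2 + s * k + (k + k + 1 + s))%N by lia.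
rewrite !addnS.
have d2 := addr1X_neq0 (s + k).+1.
have d3 := subr1X_neq0 m.
have d4 := subr1X_neq0 k.
have d6 := qpochq_neq0 k.
have d7 := qpochq_neq0 m.
have d8 := qpochNq_neq0 (s + k).
rewrite !qpochNqS !qpochqS.
move: d2 d3 d4 d6 d7 d8.
rewrite !exprS !exprD ?expr1.
move: (q ^+ k) (q ^+ m) (q ^+ s) (q ^+ (k ^ 2)) (q ^+ (s * k))
  ((-1) ^+ k) (qpoch q q k) (qpoch q q m) (qpoch (- q) q (s + k)).
move=> t p z B B' sg X X' Y d2 d3 d4 d6 d7 d8.
field.
by rewrite ?d2 ?d3 ?d4 ?d6 ?d7 ?d8.
Qed.

(** By induction on M: at k = M+1 the certificate is minus the last summand for M+1, already
    multiplied by c = (1 - q^(M+1)) (1 + q^(s+M+1)). So c times the sum for M+1 is the sum for M. *)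
Lemma vandermonde s M :
  \sum_(0 <= m < M.+1) vandermonde_term s M m
  = (qpoch q q M * qpoch (- q) q (s + M))^-1.
Proof.
elim: M => [|M IH].
  by rewrite big_nat1 /vandermonde_term !qpoch0 !muln0 !addn0 /= !expr0 !mul1r.
set c := (1 - q ^+ M.+1) * (1 + q ^+ (s + M.+1)).
have c0 : c != 0 by rewrite mulf_neq0 ?addr1X_neq0 ?subr1X_neq0.
have := vandermonde_partial s (leqnn M.+1).
rewrite sumrB -mulr_sumr IH subnn expr0 mul1r -/c => H.
apply: (mulfI c0); rewrite big_nat_recr //= mulrDr.
move/eqP: H; rewrite subr_eq -[- _ + _]addrC => /eqP ->.
rewrite -mulrA -/c [c * vandermonde_term _ _ _]mulrC subrK.
rewrite addnS qpochNqS qpochqS.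
have d2 := addr1X_neq0 (s + M).+1.
have d3 := subr1X_neq0 M.
have d6 := qpochq_neq0 M.
have d8 := qpochNq_neq0 (s + M).
rewrite /c addnS; field.
by rewrite d2 d3 d6 d8.
Qed.

(** The term a^r q^(r^2) alpha_r of the Bailey lemma at a = -1. It stands in for [term_i] without
    negative powers of q. *)
Definition bailey_summand r : R[i] :=
  (-1) ^+ r * q ^+ (r ^ 2) * ((1 + q ^+ (2 * r)) * bailey_e r).

Lemma sigma2_finite N :
  \sum_(0 <= n < N.+1) sigma2_term q n / qpoch q q (N - n)
  = \sum_(0 <= r < N.+1) bailey_summand r * bailey_w N r.
Proof.
pose F n r := (-1) ^+ n * q ^+ (n ^ 2) / qpoch q q (N - n)
  * (bailey_w n r * ((1 + q ^+ (2 * r)) * bailey_e r)).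
(* Each beta_n is expanded by [bailey_pair]; the triangle r <= n is written inside a square so that
   the sums can be exchanged. *)
transitivity (\sum_(0 <= n < N.+1) \sum_(0 <= r < N.+1 | (r < n.+1)%N) F n r).
  rewrite big_nat [RHS]big_nat; apply: eq_bigr => n /andP[_ ltnN].
  rewrite /sigma2_term -bailey_pair mulrAC mulr_sumr.
  by rewrite [LHS](big_nat_widen _ _ _ _ _ ltnN).
rewrite (exchange_big_dep_nat predT) //= big_nat [RHS]big_nat.
apply: eq_bigr => r /andP[_ ltrN].
transitivity (\sum_(r <= n < N.+1) F n r).
  by rewrite [RHS](big_nat_widenl _ _ _ _ _ (leq0n r)).
(* The shift n = m + r turns q^(n^2) into q^(m^2 + 2rm + r^2), so the inner sum is [vandermonde]
   with s = 2r and M = N - r. *)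
rewrite -{1}[r]add0n big_addn subSn //.
rewrite /bailey_summand /bailey_w.
have -> : (N + r = r.*2 + (N - r))%N by lia.
rewrite -vandermonde mulr_sumr big_nat [RHS]big_nat.
apply: eq_bigr => m /andP[_ ltmN].
rewrite /F /bailey_w /vandermonde_term addnK.
have -> : (m + r + r = r.*2 + m)%N by lia.
have -> : (N - (m + r) = N - r - m)%N by lia.
have -> : ((m + r) ^ 2 = m ^ 2 + r.*2 * m + r ^ 2)%N by nia.
rewrite !exprD.
have d1 := qpochq_neq0 (N - r - m).
have d2 := qpochq_neq0 m.
have d3 := qpochNq_neq0 (r.*2 + m).
by field; rewrite d1 d2 d3.
Qed.

(** * The inner sums of (i) and (ii), and the closed form of [bailey_e] *)

(** Truncation of the functional equation (1 + z) F(zq) = (1 - z) F(z) of F(z) = (-z;q)_oo /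
    (z;q)_oo, whose coefficients are [ratio_coef]. *)
Lemma sum_ratio_coef z n :
  (\sum_(0 <= j < n.+1) ratio_coef j * (z * q) ^+ j) * (1 + z)
  = (\sum_(0 <= j < n) ratio_coef j * z ^+ j) * (1 - z)
    + ratio_coef n * z ^+ n * (1 + z * q ^+ n).
Proof.
elim: n => [|n IH]; first by rewrite big_nat1 big_geq // !expr0; ring.
rewrite big_nat_recr //= mulrDl IH [in RHS]big_nat_recr //= ratio_coefS.
have d := subr1X_neq0 n.
rewrite exprMn (exprS z).
by field.
Qed.

Definition inner_i n : R[i] :=
  \sum_(0 <= j < n.+1) ratio_coef j * (- q ^ (1 - n%:Z)) ^+ j.

Definition inner_ii n : R[i] :=
  \sum_(0 <= m < n) ratio_coef m * (- q ^- n) ^+ m.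

Hypothesis q0 : q != 0.

Lemma inner_iE n :
  inner_i n = \sum_(0 <= j < n.+1) ratio_coef j * (- q ^- n * q) ^+ j.
Proof.
rewrite /inner_i; apply: eq_bigr => j _.
by rewrite expfzDr // expr1z exprnN mulNr [q * _]mulrC.
Qed.

(** The choice z = -q^(-n) in [sum_ratio_coef] kills the boundary factor 1 + z q^n. *)
Lemma inner_ii_i n : inner_ii n * (1 + q ^+ n) = - inner_i n * (1 - q ^+ n).
Proof.
have t0 : q ^+ n != 0 by rewrite expf_neq0.
have := sum_ratio_coef (- q ^- n) n.
rewrite -inner_iE -/(inner_ii n) mulNr mulVf // subrr mulr0 addr0 => H.
apply: (mulIf (invr_neq0 t0)).
transitivity (inner_ii n * (1 - - q ^- n)); first by field; rewrite ?t0.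
by rewrite -H; field; rewrite ?t0.
Qed.

(** Since 1 - (n+1) = -n, both sums have the same argument; they differ by the two top terms. *)
Lemma inner_iS n : inner_i n.+1 =
  inner_ii n + ratio_coef n * (- q ^- n) ^+ n
  + ratio_coef n.+1 * (- q ^- n) ^+ n.+1.
Proof.
rewrite /inner_i !big_nat_recr //=.
have -> : q ^ (1 - n.+1%:Z) = q ^- n by rewrite exprnN; congr (_ ^ _); lia.
by [].
Qed.

(** [inner_iS] followed by [inner_ii_i] is a first-order recurrence for [inner_i]; after rescaling
    it is the one defining [bailey_e]. The exponent is n(3n-1)/2. *)
Lemma bailey_eE n :
  bailey_e n = q ^+ (3 * 'C(n, 2) + n) * inner_i n / (1 + q ^+ n).
Proof.
elim: n => [|n IH].
  rewrite /inner_i big_nat1 bailey_e0 /ratio_coef !qpoch0 !expr0.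
  by rewrite !divr1 !mulr1 mul1r.
have d1 := addr1X_neq0 n.
have d2 := addr1X_neq0 n.+1.
have d3 := subr1X_neq0 n.
have d4 : q ^+ n != 0 by rewrite expf_neq0.
have d5 : q ^+ 'C(n, 2) != 0 by rewrite expf_neq0.
have HT : inner_ii n = - inner_i n * (1 - q ^+ n) / (1 + q ^+ n).
  by rewrite -inner_ii_i mulfK.
rewrite bailey_eS IH inner_iS HT ratio_coefS.
have -> : (- q ^- n) ^+ n.+1 = (- q ^- n) ^+ n * (- q ^- n) by rewrite exprSr.
(* Here q^(-n^2) is expressed through q^C(n,2) and q^n, the atoms used by [field]. *)
have -> : (- q ^- n) ^+ n = (-1) ^+ n / (q ^+ 'C(n, 2) ^+ 2 * q ^+ n).
  by rewrite [LHS]exprNn exprVn -!exprM -exprD -muln_bin2.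
rewrite !binS !bin1 !bin0.
have -> : ('C(n, 2) + n + (n + 1) = 'C(n, 2) + n + n + 1)%N by lia.
have -> : (3 * ('C(n, 2) + n) + n.+1
    = ('C(n, 2) + 'C(n, 2) + 'C(n, 2) + n + n + n + n).+1)%N by lia.
have -> : (3 * 'C(n, 2) + n = 'C(n, 2) + 'C(n, 2) + 'C(n, 2) + n)%N by lia.
have -> : (3 * n = n + n + n)%N by lia.
rewrite mul2n -addnn.
move: d1 d2 d3 d4 d5.
rewrite !exprS !exprD !expr1.
move: (q ^+ n) (q ^+ 'C(n, 2)) (ratio_coef n) (inner_i n) ((-1) ^+ n) => t B A S sg.
move=> d1 d2 d3 d4 d5.
by field; rewrite ?d1 ?d2 ?d3 ?d4 ?d5.
Qed.

(** The exponent n(5n-1)/2 is n^2 from the Bailey lemma plus n(3n-1)/2 from [bailey_eE]. *)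
Lemma term_i_neq0 n : term_i q n = bailey_summand n.
Proof.
have d := addr1X_neq0 n.
rewrite /term_i -/(inner_i n) /bailey_summand bailey_eE.
have -> : ((n * (5 * n - 1))./2 = n ^ 2 + (3 * 'C(n, 2) + n))%N.
  by have := muln_bin2 n; nia.
by rewrite exprD; field.
Qed.

Lemma term_ii_neq0 n : term_ii q n.+1 = - term_i q n.+1.
Proof.
have d1 := addr1X_neq0 n.+1.
have d2 := subr1X_neq0 n.
rewrite /term_ii -/(inner_ii n.+1) /term_i -/(inner_i n.+1).
have -> : inner_ii n.+1 = - inner_i n.+1 * (1 - q ^+ n.+1) / (1 + q ^+ n.+1).
  by rewrite -inner_ii_i mulfK.
by field; rewrite d1 d2.
Qed.

End Algebra.

(** * Geometric bounds and limits of complex sequences *)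

Lemma sum_geom_le (K : numFieldType) (rho : K) m n : 0 <= rho -> rho < 1 ->
  \sum_(m <= k < n) rho ^+ k <= rho ^+ m / (1 - rho).
Proof.
move=> rho0 rho1; have d : 0 < 1 - rho by rewrite subr_gt0.
have [lemn|ltnm] := leqP m n; last first.
  by rewrite big_geq ?(ltnW ltnm) // divr_ge0 ?exprn_ge0 // ltW.
rewrite ler_pdivlMr //.
suff -> : (\sum_(m <= k < n) rho ^+ k) * (1 - rho) = rho ^+ m - rho ^+ n.
  by rewrite gerBl exprn_ge0.
elim: n lemn => [|n IH].
  by rewrite leqn0 => /eqP ->; rewrite big_geq // subrr mul0r.
rewrite leq_eqVlt => /orP[/eqP ->|lemn].
  by rewrite big_geq // subrr mul0r.
by rewrite big_nat_recr //= mulrDl IH // exprS; ring.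
Qed.

Section ComplexLimits.
Variable R : realType.
Implicit Types (rho c : R[i]).

Lemma ge0_complex c : 0 <= c -> exists2 x : R, 0 <= x & c = x%:C.
Proof.
move=> c0; have /complex_realP[x cx] := ger0_real c0.
by exists x => //; rewrite -lecR -cx.
Qed.

Lemma normc_real (x : R) : `|x%:C| = `|x|%:C.
Proof. by rewrite normc_def /= expr0n addr0 sqrtr_sqr. Qed.

(** From 1 + y <= exp(y), the product is at most the exponential of a geometric sum. *)
Lemma prod_norm_bounded (u : nat -> R[i]) c rho :
  0 <= c -> 0 <= rho -> rho < 1 -> (forall k, `|u k| <= 1 + c * rho ^+ k) ->
  exists2 B, 0 <= B & forall n, `|\prod_(0 <= k < n) u k| <= B.
Proof.
move=> /ge0_complex[x x0 ->] /ge0_complex[r r0 ->] r1 hu.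
have {}r1 : r < 1 by rewrite -ltcR.
exists (expR (x / (1 - r)))%:C => [|n]; first by rewrite ler0c expR_ge0.
rewrite normr_prod.
apply: (@le_trans _ _ (\prod_(0 <= k < n) (1 + x * r ^+ k))%:C).
  rewrite rmorph_prod; apply: ler_prod => k _; rewrite normr_ge0 /=.
  by apply: le_trans (hu k) _; rewrite rmorphD rmorphM rmorphXn rmorph1.
rewrite lecR.
apply: (@le_trans _ _ (\prod_(0 <= k < n) expR (x * r ^+ k))).
  apply: ler_prod => k _; rewrite expR_ge1Dx andbT.
  by rewrite addr_ge0 // mulr_ge0 // exprn_ge0.
rewrite -expR_sum ler_expR -mulr_sumr ler_wpM2l //.
by rewrite -[_^-1]mul1r; exact: (@sum_geom_le _ r 0).
Qed.

Lemma cvgn_complex (u : nat -> R) (l : R) :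
  u @ \oo --> l -> (fun n => (u n)%:C) @ \oo --> l%:C.
Proof.
move=> ul; apply/cvgrPdist_lt => e e0.
have [x x0 ex] := ge0_complex (ltW e0).
have {}x0 : 0 < x by rewrite -ltcR -ex.
move/cvgrPdist_lt: ul => /(_ x x0) [N _ HN].
by exists N => // n /HN; rewrite ex /= -rmorphB normc_real ltcR.
Qed.

Lemma Re_norm_le (z : R[i]) : `|complex.Re z|%:C <= `|z|.
Proof.
rewrite normc_def lecR -[`|complex.Re z|]sqrtr_sqr.
by rewrite ler_wsqrtr // lerDl sqr_ge0.
Qed.

Lemma Im_norm_le (z : R[i]) : `|complex.Im z|%:C <= `|z|.
Proof.
rewrite normc_def lecR -[`|complex.Im z|]sqrtr_sqr.
by rewrite ler_wsqrtr // lerDr sqr_ge0.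
Qed.

Lemma cvgn_geom_dominated (v : nat -> R) (x r : R) : 0 <= r -> r < 1 ->
  (forall n, `|v n| <= x * r ^+ n) -> cvgn (series v).
Proof.
move=> r0 r1 hv; apply: normed_cvg.
apply: (@series_le_cvg _ _ (geometric x r)) => [n|n|n|].
- exact: normr_ge0.
- exact: le_trans (hv n).
- exact: hv.
by apply: is_cvg_geometric_series; rewrite ger0_norm.
Qed.

(** Real and imaginary parts are dominated by a real geometric series, so comparison over [R]
    applies to each. *)
Lemma cvgn_sum_geom_dominated (u : nat -> R[i]) c rho : 0 <= rho -> rho < 1 ->
  (forall n, `|u n| <= c * rho ^+ n) ->
  cvgn (fun N => \sum_(0 <= n < N) u n).
Proof.
move=> rho0 rho1 hu.
have c0 : 0 <= c by have := le_trans (normr_ge0 _) (hu 0%N); rewrite expr0 mulr1.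
move: rho0 rho1 c0 hu.
move=> /ge0_complex[r r0 ->] r1 /ge0_complex[x x0 ->] hu.
have {}r1 : r < 1 by rewrite -ltcR.
have cRe : cvgn (series (fun n => complex.Re (u n))).
  apply: (@cvgn_geom_dominated _ x r) => // n.
  by rewrite -lecR rmorphM rmorphXn; apply: le_trans (Re_norm_le _) (hu n).
have cIm : cvgn (series (fun n => complex.Im (u n))).
  apply: (@cvgn_geom_dominated _ x r) => // n.
  by rewrite -lecR rmorphM rmorphXn; apply: le_trans (Im_norm_le _) (hu n).
apply/cvg_ex; exists ((limn (series (fun n => complex.Re (u n))))%:C
  + 'i * (limn (series (fun n => complex.Im (u n))))%:C).
have -> : (fun N => \sum_(0 <= n < N) u n) =
   (fun N => (series (fun n => complex.Re (u n)) N)%:C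
          + 'i * (series (fun n => complex.Im (u n)) N)%:C).
  apply/funext => N; rewrite /series /= !rmorph_sum mulr_sumr -big_split /=.
  by apply: eq_bigr => n _; rewrite -complexE.
apply: cvgD; first exact: cvgn_complex.
apply: cvgM; first exact: cvg_cst.
exact: cvgn_complex.
Qed.

Lemma cvgn_geom0 (u : nat -> R[i]) c rho : 0 <= rho -> rho < 1 ->
  (forall n, `|u n| <= c * rho ^+ n) -> u @ \oo --> (0 : R[i]).
Proof.
move=> rho0 rho1 hu.
have c0 : 0 <= c by have := le_trans (normr_ge0 _) (hu 0%N); rewrite expr0 mulr1.
move: rho0 rho1 c0 hu.
move=> /ge0_complex[r r0 ->] r1 /ge0_complex[x x0 ->] hu.
have {}r1 : r < 1 by rewrite -ltcR.
have := @cvg_geometric _ x r; rewrite ger0_norm // => /(_ r1) /cvgn_complex.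
move=> /cvgrPdist_lt H; apply/cvgrPdist_lt => e e0.
have [N _ HN] := H e e0; exists N => // n /HN /=.
apply: le_lt_trans; rewrite !sub0r !normrN normc_real.
by rewrite (@ger0_norm _ (x * r ^+ n)) ?mulr_ge0 ?exprn_ge0 // rmorphM rmorphXn.
Qed.

End ComplexLimits.

(** * Uniform bounds and the error estimate *)

Section Analysis.
Variables (R : realType) (q : R[i]).
Hypothesis hq : `|q| < 1.
Let rho : R[i] := `|q|.
Let rho0 : 0 <= rho. Proof. exact: normr_ge0. Qed.
Let rho_sub : 0 < 1 - rho. Proof. by rewrite subr_gt0. Qed.

Let rhoX_le m n : (m <= n)%N -> rho ^+ n <= rho ^+ m.
Proof. by move=> h; apply: ler_wiXn2l => //; exact: ltW. Qed.

Lemma qpoch_bounded a : exists2 B, 0 <= B & forall n, `|qpoch a q n| <= B.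
Proof.
apply: (@prod_norm_bounded _ _ `|a| rho) => // k.
by rewrite (le_trans (ler_normB _ _)) // normr1 normrM normrX.
Qed.

(** With x = |a| rho^k, an inverse factor is at most 1/(1-x) = 1 + x/(1-x), and 1 - x >= 1 - |a|
    brings this to the form of [prod_norm_bounded]. *)
Lemma qpochV_bounded a : `|a| < 1 ->
  exists2 B, 0 <= B & forall n, `|(qpoch a q n)^-1| <= B.
Proof.
move=> a1; have da : 0 < 1 - `|a| by rewrite subr_gt0.
have [B B0 HB] : exists2 B, 0 <= B &
    forall n, `|\prod_(0 <= k < n) (1 - a * q ^+ k)^-1| <= B.
  apply: (@prod_norm_bounded _ _ (`|a| / (1 - `|a|)) rho) => //.
    by rewrite divr_ge0 // ltW.
  move=> k; set x := `|a| * rho ^+ k.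
  have x0 : 0 <= x by rewrite mulr_ge0 // exprn_ge0.
  have xa : x <= `|a| by rewrite ler_piMr // exprn_ile1 // ltW.
  have dx : 0 < 1 - x by rewrite subr_gt0 (le_lt_trans xa).
  have hx : 1 - x <= `|1 - a * q ^+ k|.
    apply: le_trans (lerB_dist _ _).
    by rewrite normr1 normrM normrX.
  rewrite normfV (le_trans (_ : _ <= (1 - x)^-1)) //.
    by rewrite lef_pV2 // posrE // (lt_le_trans dx).
  rewrite mulrAC -/x.
  have -> : (1 - x)^-1 = 1 + x / (1 - x) by field; rewrite gt_eqF.
  by rewrite lerD2l ler_wpM2l // lef_pV2 // ?posrE // lerB.
by exists B => // n; rewrite /qpoch -prodfV.
Qed.

Lemma qpoch_sub_le a : exists2 B, 0 <= B &
  forall m n, (m <= n)%N -> `|qpoch a q n - qpoch a q m| <= B * rho ^+ m.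
Proof.
have [B B0 HB] := qpoch_bounded a.
exists (B * `|a| / (1 - rho)) => [|m n lemn].
  by rewrite divr_ge0 ?mulr_ge0 // ltW.
rewrite -telescope_sumr // (le_trans (ler_norm_sum _ _ _)) //.
apply: (@le_trans _ _ (\sum_(m <= k < n) B * `|a| * rho ^+ k)).
  apply: ler_sum => k _.
  have -> : qpoch a q k.+1 - qpoch a q k = - (qpoch a q k * a * q ^+ k).
    by rewrite qpochS; ring.
  rewrite normrN !normrM normrX ler_wpM2r ?exprn_ge0 //.
  by rewrite ler_wpM2r.
rewrite -mulr_sumr -!mulrA ler_wpM2l // ler_wpM2l // mulrC.
exact: sum_geom_le.
Qed.

Let invD_bounded n : `|(1 + q ^+ n.+1)^-1| <= (1 - rho)^-1.
Proof.
have h : 1 - rho <= `|1 + q ^+ n.+1|.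
  rewrite -[q ^+ n.+1]opprK; apply: le_trans (lerB_dist _ _).
  by rewrite normrN normr1 normrX lerB // -/rho exprS ler_piMr // exprn_ile1 // ltW.
by rewrite normfV lef_pV2 // posrE // (lt_le_trans rho_sub).
Qed.

Let invB_bounded n : `|(1 - q ^+ n.+1)^-1| <= (1 - rho)^-1.
Proof.
have h : 1 - rho <= `|1 - q ^+ n.+1|.
  apply: le_trans (lerB_dist _ _).
  by rewrite normr1 normrX lerB // -/rho exprS ler_piMr // exprn_ile1 // ltW.
by rewrite normfV lef_pV2 // posrE // (lt_le_trans rho_sub).
Qed.

Let normD_le2 n : `|1 + q ^+ n| <= 2.
Proof.
rewrite (le_trans (ler_normD _ _)) // normr1 normrX (natrD _ 1 1) lerD2l.
by rewrite exprn_ile1 // ltW.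
Qed.

Let normB_le2 n : `|1 - q ^+ n| <= 2.
Proof.
rewrite (le_trans (ler_normB _ _)) // normr1 normrX (natrD _ 1 1) lerD2l.
by rewrite exprn_ile1 // ltW.
Qed.

(** The recurrence gives v(n+1) <= (1 + K rho^n) v(n) for v(n) = 1 + |[bailey_e q n]|, and the
    product of these factors is bounded. *)
Lemma bailey_e_bounded : exists2 B, 0 <= B & forall n, `|bailey_e q n| <= B.
Proof.
have [B1 B10 HB1] := qpoch_bounded (-1).
have [B2 B20 HB2] := qpochV_bounded hq.
pose D := (1 - rho)^-1.
have D0 : 0 <= D by rewrite invr_ge0 ltW.
pose K := 2 * D + B1 * B2 * 2 * (D * D).
have K0 : 0 <= K by rewrite addr_ge0 ?mulr_ge0.
have step n : `|bailey_e q n.+1| <= K * rho ^+ n * (1 + `|bailey_e q n|).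
  rewrite bailey_eS; apply: le_trans (ler_normD _ _) _.
  rewrite [leRHS]mulrDr mulr1 [leRHS]addrC.
  have h1 : `|(-1) ^+ n.+1 * ratio_coef q n * q ^+ 'C(n.+2, 2)
      * (1 + q ^+ (2 * n).+1) / ((1 + q ^+ n.+1) * (1 - q ^+ n.+1))|
      <= (B1 * B2 * 2 * (D * D)) * rho ^+ n.
    rewrite /ratio_coef invfM !normrM normrX normrN1 expr1n mul1r normrX -/rho.
    rewrite -!mulrA [rho ^+ _ * _]mulrC !mulrA.
    apply: ler_pM => //; rewrite ?exprn_ge0 ?mulr_ge0 //.
      by do !(apply: ler_pM; rewrite ?mulr_ge0 //).
    by apply: rhoX_le; rewrite !binS bin0 bin1; lia.
  have h2 : `|- (q ^+ (3 * n).+1 * (1 - q ^+ n) / (1 + q ^+ n.+1))|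
      <= 2 * D * rho ^+ n.
    rewrite normrN !normrM normrX -/rho -mulrA mulrC.
    apply: ler_pM => //; rewrite ?exprn_ge0 ?mulr_ge0 //.
      by apply: ler_pM.
    by apply: rhoX_le; lia.
  rewrite normrM; apply: lerD; last first.
    apply: le_trans h1 _; rewrite ler_wpM2r ?exprn_ge0 // /K lerDr.
    by rewrite !mulr_ge0.
  apply: ler_wpM2r => //; apply: le_trans h2 _.
  rewrite ler_wpM2r ?exprn_ge0 // /K lerDl.
  by rewrite !mulr_ge0.
have [B B0 HB] : exists2 B, 0 <= B &
    forall n, `|\prod_(0 <= k < n) (1 + K * rho ^+ k)| <= B.
  apply: (@prod_norm_bounded _ _ K rho) => // k.
  by rewrite ger0_norm // addr_ge0 // mulr_ge0 // exprn_ge0.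
pose v n := 1 + `|bailey_e q n|.
have v0 n : 0 <= v n by rewrite addr_ge0.
have vle n : v n <= v 0%N * \prod_(0 <= k < n) (1 + K * rho ^+ k).
  elim: n => [|n IH]; first by rewrite big_geq // mulr1.
  rewrite big_nat_recr //= mulrA.
  apply: (@le_trans _ _ (v n * (1 + K * rho ^+ n))); last first.
    by rewrite ler_wpM2r // addr_ge0 // mulr_ge0 // exprn_ge0.
  rewrite mulrDr mulr1 [X in _ <= X + _]/v -addrA lerD2l mulrC.
  by rewrite (le_trans (step n)) // lerDr.
exists (v 0%N * B) => [|n]; first by rewrite mulr_ge0.
apply: (@le_trans _ _ (v n)); first by rewrite lerDr.
apply: le_trans (vle n) _; rewrite ler_wpM2l //.
apply: le_trans (HB n); rewrite ger0_norm //.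
by apply: prodr_ge0 => k _; rewrite addr_ge0 // mulr_ge0 // exprn_ge0.
Qed.

Lemma bailey_summand_le : exists2 B, 0 <= B &
  forall n, `|bailey_summand q n| <= B * rho ^+ (n ^ 2).
Proof.
have [B B0 HB] := bailey_e_bounded.
exists (2 * B) => [|n]; first by rewrite mulr_ge0.
rewrite /bailey_summand !normrM !normrX normrN1 expr1n mul1r mulrC.
by rewrite ler_wpM2r ?exprn_ge0 // ler_pM.
Qed.

Lemma sigma2_term_le : exists2 B, 0 <= B &
  forall n, `|sigma2_term q n| <= B * rho ^+ (n ^ 2).
Proof.
have [|B B0 HB] := @qpochV_bounded (- q); first by rewrite normrN.
exists B => // n.
rewrite /sigma2_term !normrM !normrX normrN1 expr1n mul1r mulrC.
by rewrite ler_wpM2r ?exprn_ge0.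
Qed.

Lemma bailey_summand0 : bailey_summand q 0 = 1.
Proof.
by rewrite /bailey_summand bailey_e0 !expr0 !mul1r mulfV // pnatr_eq0.
Qed.

Lemma half_pentagonal_gt0 n : (0 < (n.+1 * (5 * n.+1 - 1))./2)%N.
Proof. by rewrite half_gt0; nia. Qed.

(** At q = 0 both sides vanish, as the exponents n(5n-1)/2 and n^2 are positive for n >= 1. *)
Lemma term_i_alpha n : term_i q n.+1 = bailey_summand q n.+1.
Proof.
have [q0|q0] := eqVneq q 0; last exact: term_i_neq0.
rewrite /term_i /bailey_summand q0 [0 ^+ _./2]expr0n gtn_eqF ?half_pentagonal_gt0 //.
by rewrite [0 ^+ (_ ^ 2)]expr0n expn_eq0 /= !mulr0 !mul0r.
Qed.

Lemma term_ii_alpha n : term_ii q n.+1 = - bailey_summand q n.+1.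
Proof.
have [q0|q0] := eqVneq q 0; last by rewrite term_ii_neq0 // term_i_neq0.
rewrite /term_ii /bailey_summand q0 [0 ^+ _./2]expr0n gtn_eqF ?half_pentagonal_gt0 //.
by rewrite [0 ^+ (_ ^ 2)]expr0n expn_eq0 /= !mulr0 !mul0r oppr0.
Qed.

Lemma sum_square_geom_le N :
  \sum_(0 <= n < N.+1) rho ^+ (n ^ 2) * rho ^+ (N - n)
  <= (1 + (1 - rho)^-1) * rho ^+ N.
Proof.
rewrite big_nat_recl // expr0 mul1r subn0 mulrDl mul1r lerD2l.
(* After the shift by one, (n+1)^2 + N - (n+1) >= n + N. *)
apply: (@le_trans _ _ (\sum_(0 <= n < N) rho ^+ n * rho ^+ N)).
  rewrite big_nat [leRHS]big_nat; apply: ler_sum => n /andP[_ ltnN].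
  by rewrite -!exprD; apply: rhoX_le; nia.
rewrite -mulr_suml ler_wpM2r ?exprn_ge0 //.
by have := sum_geom_le 0 N rho0 hq; rewrite expr0 mul1r.
Qed.

(** In [sigma2_finite] times (q;q)_N, replacing (q;q)_N / (q;q)_(N-n) by 1 and (-q;q)_(N+n) by
    (-q;q)_N costs O(rho^(N-n)) per term, against terms of size O(rho^(n^2)). *)
Lemma sigma2_alpha_close : exists2 B, 0 <= B & forall N,
  `|\sum_(0 <= n < N.+1) sigma2_term q n
    - (qpoch (- q) q N)^-1 * \sum_(0 <= r < N.+1) bailey_summand q r|
  <= B * rho ^+ N.
Proof.
have hNq : `|- q| < 1 by rewrite normrN.
have [A A0 HA] := bailey_summand_le.
have [S S0 HS] := sigma2_term_le.
have [P P0 HP] := qpochV_bounded hq.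
have [Q Q0 HQ] := qpochV_bounded hNq.
have [C C0 HC] := qpoch_sub_le q.
have [D D0 HD] := qpoch_sub_le (- q).
pose K := S * C * P + A * (C * P * Q + D * Q * Q).
have K0 : 0 <= K by rewrite !(addr_ge0, mulr_ge0).
exists (K * (1 + (1 - rho)^-1)) => [|N].
  by rewrite mulr_ge0 // addr_ge0 // invr_ge0 ltW.
have -> : \sum_(0 <= n < N.+1) sigma2_term q n
    - (qpoch (- q) q N)^-1 * \sum_(0 <= r < N.+1) bailey_summand q r
  = \sum_(0 <= n < N.+1)
     (sigma2_term q n * ((qpoch q q (N - n) - qpoch q q N) / qpoch q q (N - n))
     + bailey_summand q n *
       ((qpoch q q N - qpoch q q (N - n)) / qpoch q q (N - n) / qpoch (- q) q (N + n)
        - (qpoch (- q) q (N + n) - qpoch (- q) q N)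
           / qpoch (- q) q (N + n) / qpoch (- q) q N)).
  have := congr1 ( *%R (qpoch q q N)) (sigma2_finite hq N).
  rewrite !mulr_sumr => H.
  (* The two sums inserted with opposite signs are equal by [H]. *)
  transitivity (\sum_(0 <= n < N.+1) sigma2_term q n
    - \sum_(0 <= n < N.+1) qpoch q q N * (sigma2_term q n / qpoch q q (N - n))
    + (\sum_(0 <= n < N.+1) qpoch q q N * (bailey_summand q n * bailey_w q N n)
    - \sum_(0 <= r < N.+1) (qpoch (- q) q N)^-1 * bailey_summand q r)).
    by rewrite H addrA subrK.
  rewrite -!sumrB -big_split /=; apply: eq_bigr => n _.
  rewrite /bailey_w.
  have d1 := qpochq_neq0 hq (N - n).
  have d2 := qpochNq_neq0 hq (N + n).
  have d3 := qpochNq_neq0 hq N.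
  by field; rewrite d1 d2 d3.
apply: le_trans (ler_norm_sum _ _ _) _.
apply: (@le_trans _ _ (\sum_(0 <= n < N.+1)
    K * (rho ^+ (n ^ 2) * rho ^+ (N - n)))); last first.
  by rewrite -mulr_sumr -mulrA ler_wpM2l // sum_square_geom_le.
rewrite big_nat [leRHS]big_nat; apply: ler_sum => n /andP[_ ltnN].
have hC : `|qpoch q q N - qpoch q q (N - n)| <= C * rho ^+ (N - n).
  by apply: HC; rewrite leq_subr.
have hD : `|qpoch (- q) q (N + n) - qpoch (- q) q N| <= D * rho ^+ (N - n).
  apply: (@le_trans _ _ (D * rho ^+ N)); first by apply: HD; rewrite leq_addr.
  by rewrite ler_wpM2l // rhoX_le // leq_subr.
apply: (@le_trans _ _ (S * rho ^+ (n ^ 2) * (C * rho ^+ (N - n) * P)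
   + A * rho ^+ (n ^ 2) * (C * rho ^+ (N - n) * P * Q + D * rho ^+ (N - n) * Q * Q))).
  apply: le_trans (ler_normD _ _) _; apply: lerD.
    rewrite normrM ler_pM //.
    by rewrite normrM ler_pM // distrC.
  rewrite normrM ler_pM //.
  apply: le_trans (ler_normB _ _) _; apply: lerD.
    by rewrite normrM ler_pM // normrM ler_pM.
  by rewrite normrM ler_pM // normrM ler_pM.
rewrite le_eqVlt; apply/orP; left; apply/eqP.
by rewrite /K; ring.
Qed.

(** * Convergence and passage to the limit *)

Lemma cvgn_qpoch a : cvgn (qpoch a q).
Proof.
have [B B0 HB] := qpoch_bounded a.
have H : cvgn (fun N => \sum_(0 <= n < N) (qpoch a q n.+1 - qpoch a q n)).
  apply: (@cvgn_sum_geom_dominated _ _ (B * `|a|) rho) => // n.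
  have -> : qpoch a q n.+1 - qpoch a q n = - (qpoch a q n * a * q ^+ n).
    by rewrite qpochS; ring.
  rewrite normrN !normrM normrX ler_wpM2r ?exprn_ge0 //.
  by rewrite ler_wpM2r.
have -> : qpoch a q =
    (fun N => 1 + \sum_(0 <= n < N) (qpoch a q n.+1 - qpoch a q n)).
  by apply/funext => N; rewrite telescope_sumr // qpoch0 addrC subrK.
have /cvg_ex[l Hl] := H; apply/cvg_ex; exists (1 + l).
by apply: cvgD; [exact: cvg_cst|exact: Hl].
Qed.

Lemma qpoch_infty_neq0 : limn (qpoch (- q) q) != 0.
Proof.
have hNq : `|- q| < 1 by rewrite normrN.
have [B B0 HB] := qpochV_bounded hNq.
apply/eqP => h; have := @cvgn_qpoch (- q); rewrite h.
(* A limit 0 would make some partial product smaller than 1/(B+1), while its inverse is at most B;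
   adding 1 guards against B = 0. *)
move=> /cvgrPdist_lt /(_ (B + 1)^-1).
have B1 : 0 < B + 1 by rewrite ltr_wpDl.
rewrite invr_gt0 => /(_ B1) [N _ /(_ N (leqnn N))] /=.
rewrite sub0r normrN => hN; have d := qpochNq_neq0 hq N.
have h1 : 1 <= `|qpoch (- q) q N| * (B + 1).
  apply: (@le_trans _ _ (`|qpoch (- q) q N| * B)); last first.
    by rewrite ler_wpM2l // lerDl.
  rewrite -(mulfV (_ : `|qpoch (- q) q N| != 0)) ?normr_eq0 //.
  by rewrite ler_wpM2l // -normfV.
have := hN; rewrite -[ltRHS]mul1r ltr_pdivlMr // => /(le_lt_trans h1).
by rewrite ltxx.
Qed.

Lemma cvgn_bailey_summand :
  cvgn (fun N => \sum_(0 <= n < N) bailey_summand q n).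
Proof.
have [B B0 HB] := bailey_summand_le.
apply: (@cvgn_sum_geom_dominated _ _ B rho) => // n.
by apply: le_trans (HB n) _; rewrite ler_wpM2l // rhoX_le //; nia.
Qed.

Lemma cvgn_sigma2 : cvgn (fun N => \sum_(0 <= n < N) sigma2_term q n).
Proof.
have [B B0 HB] := sigma2_term_le.
apply: (@cvgn_sum_geom_dominated _ _ B rho) => // n.
by apply: le_trans (HB n) _; rewrite ler_wpM2l // rhoX_le //; nia.
Qed.

Lemma sigma2_alpha : sigma2 q = 1 / qpoch_infty (- q) q
  * limn (fun N => \sum_(0 <= n < N) bailey_summand q n).
Proof.
have Y0 := qpoch_infty_neq0.
have [B B0 HB] := sigma2_alpha_close.
have H0 := cvgn_geom0 rho0 hq HB.
have H1 : (fun N => \sum_(0 <= n < N.+1) sigma2_term q n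
    - (qpoch (- q) q N)^-1 * \sum_(0 <= r < N.+1) bailey_summand q r) @ \oo -->
  sigma2 q - (limn (qpoch (- q) q))^-1
    * limn (fun N => \sum_(0 <= n < N) bailey_summand q n).
  apply: cvgB.
    by have := cvgn_sigma2; rewrite -(cvg_shiftS _).
  apply: cvgM; first by apply: cvgV; [exact: Y0|exact: cvgn_qpoch].
  by have := cvgn_bailey_summand; rewrite -(cvg_shiftS _).
have E : sigma2 q - (limn (qpoch (- q) q))^-1
    * limn (fun N => \sum_(0 <= n < N) bailey_summand q n) = 0.
  exact: (cvg_unique (@norm_hausdorff _ _) H1 H0).
rewrite (subr0_eq E).
by rewrite div1r.
Qed.

End Analysis.

Theorem theorem1p5 (R : realType) (q : R[i]) (hq : `|q| < 1) :
  [/\ cvgn (fun N : nat => \sum_(0 <= n < N) sigma2_term q n),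
      cvgn (qpoch (- q) q) /\ qpoch_infty (- q) q != 0,
      cvgn (fun N : nat => \sum_(1 <= n < N) term_i q n) /\
      sigma2 q = 1 / qpoch_infty (- q) q
                 * (1 + (\big[+%R/0%R]_(1 <= n <oo) term_i q n)%BIG)
    & cvgn (fun N : nat => \sum_(1 <= n < N) term_ii q n) /\
      sigma2 q = 1 / qpoch_infty (- q) q
                 * (1 - (\big[+%R/0%R]_(1 <= n <oo) term_ii q n)%BIG)].
Proof.
pose L : R[i] := limn (fun N => \sum_(0 <= n < N) bailey_summand q n).
(* The summand of index 0 is the 1 inside the braces of (i) and (ii). *)
have Hs N : \sum_(0 <= n < N.+1) bailey_summand q n
    = 1 + \sum_(1 <= n < N.+1) term_i q n.
  rewrite big_nat_recl // bailey_summand0 [in RHS]big_add1; congr (_ + _).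
  by apply: eq_bigr => n _; rewrite term_i_alpha.
have Hi : (fun N => \sum_(1 <= n < N) term_i q n) @ \oo --> L - 1.
  have HL : (fun N => \sum_(0 <= n < N.+1) bailey_summand q n) @ \oo --> L.
    by have := cvgn_bailey_summand hq; rewrite -(cvg_shiftS _).
  have : (fun N => \sum_(0 <= n < N.+1) bailey_summand q n - 1) @ \oo --> L - 1.
    by refine (cvgB HL (cvg_cst _)).
  have -> : (fun N => \sum_(0 <= n < N.+1) bailey_summand q n - 1)
      = (fun N => \sum_(1 <= n < N.+1) term_i q n).
    by apply/funext => N; rewrite Hs addrC addKr.
  by rewrite (cvg_shiftS (fun N => \sum_(1 <= n < N) term_i q n)).
have Hii : (fun N => \sum_(1 <= n < N) term_ii q n) @ \oo --> - (L - 1).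
  have -> : (fun N => \sum_(1 <= n < N) term_ii q n)
      = (fun N => - \sum_(1 <= n < N) term_i q n).
    apply/funext => N; rewrite -sumrN big_nat [RHS]big_nat.
    (* The sign relation between the two terms is used for n >= 1 only; the range excludes n = 0. *)
    by apply: eq_bigr => -[|n] // _; rewrite term_i_alpha // term_ii_alpha.
  exact: (cvgN Hi).
have limi : limn (fun N => \sum_(1 <= n < N) term_i q n) = L - 1.
  exact: (cvg_lim (@norm_hausdorff _ _) Hi).
have limii : limn (fun N => \sum_(1 <= n < N) term_ii q n) = - (L - 1).
  exact: (cvg_lim (@norm_hausdorff _ _) Hii).
have HL : 1 + (L - 1) = L by rewrite addrC subrK.
split.
- exact: cvgn_sigma2.
- by split; [exact: cvgn_qpoch|exact: qpoch_infty_neq0].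
- split; first by apply/cvg_ex; exists (L - 1); exact: Hi.
  by rewrite (sigma2_alpha hq) limi HL.
- split; first by apply/cvg_ex; exists (- (L - 1)); exact: Hii.
  by rewrite (sigma2_alpha hq) limii opprK HL.
Qed.
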